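(* Let $\kappa$ be an uncountable cardinal. For any ${<}\kappa$-distributive forcing $\mathbb{P}$, $\mathsf{ub}\text{-}\mathsf{FA}_{\mathbb{P},\kappa}$ implies $\mathsf{FA}_{\mathbb{P},\kappa}$.
   Context: A forcing is a partial order with a largest element; it is ${<}\kappa$-distributive if the intersection of fewer than $\kappa$ many open dense subsets is dense. $\mathsf{FA}_{\mathbb{P},\kappa}$: for any sequence $\langle D_\alpha\mid\alpha<\kappa\rangle$ of dense subsets of $\mathbb{P}$ there is a filter $g\in V$ on $\mathbb{P}$ with $g\cap D_\alpha\neq\emptyset$ for all $\alpha<\kappa$. $\mathsf{ub}\text{-}\mathsf{FA}_{\mathbb{P},\kappa}$: for any such sequence there is a filter $g\in V$ on $\mathbb{P}$ with $g\cap D_\alpha\neq\emptyset$ for unboundedly many $\alpha<\kappa$. Here $V$ is the universe (ground model). *)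

(* Defs.v *)
From mathcomp Require Import all_boot all_order.
From mathcomp Require Import wochoice all_classical.

Set Implicit Arguments.
Unset Strict Implicit.
Unset Printing Implicit Defensive.

Import Order.TTheory.

Local Open Scope classical_set_scope.
Local Open Scope card_scope.
Local Open Scope order_scope.

Definition card_lt (T U : Type) (A : set T) (B : set U) : Prop :=
  A #<= B /\ ~ (B #<= A).

(* A cardinal is an initial ordinal: the type [K] stands for its set of
   elements { alpha | alpha < kappa }, ordered as ordinals. *)
Definition is_cardinal (d : Order.disp_t) (K : orderType d) : Prop :=
  well_order (<=%O : rel K) /\
  forall a : K, card_lt [set x : K | x < a] [set: K].

Definition is_uncountable_cardinal (d : Order.disp_t) (K : orderType d) : Prop :=
  is_cardinal K /\ ~ countable [set: K].

(* A forcing is a [tPOrderType]; [q <= p] means that [q] is stronger than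
   [p], and [\top] is the largest (weakest) condition. *)
Section Forcing.
Variables (d : Order.disp_t) (P : tPOrderType d).

Definition forcing_dense (D : set P) : Prop :=
  forall p : P, exists2 q : P, D q & q <= p.

Definition forcing_open (D : set P) : Prop :=
  forall p q : P, D p -> q <= p -> D q.

Definition forcing_filter (g : set P) : Prop :=
  [/\ g !=set0,
      forall p q : P, g p -> p <= q -> g q
    & forall p q : P, g p -> g q -> exists r : P, [/\ g r, r <= p & r <= q]].

(* The largest condition belongs to every filter, so [g !=set0] amounts to
   [g \top]. *)
Lemma forcing_filter_top (g : set P) : forcing_filter g -> g \top.
Proof. by case=> -[p gp] gup _; apply: gup gp (lex1 p). Qed.

Variables (d' : Order.disp_t) (K : orderType d').

Definition lt_distributive : Prop :=
  forall F : set (set P),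
    card_lt F [set: K] ->
    (forall D, F D -> forcing_open D /\ forcing_dense D) ->
    forcing_dense (\bigcap_(D in F) D).

Definition FA : Prop :=
  forall D : K -> set P,
    (forall a, forcing_dense (D a)) ->
    exists2 g : set P, forcing_filter g & forall a : K, g `&` D a !=set0.

Definition ub_FA : Prop :=
  forall D : K -> set P,
    (forall a, forcing_dense (D a)) ->
    exists2 g : set P, forcing_filter g &
      ~ has_ubound [set a : K | g `&` D a !=set0].

End Forcing.

(* Main.v *)
Require Import Defs.
From mathcomp Require Import all_boot all_order.
From mathcomp Require Import all_classical.

(** Replace each dense set [D b] by its downward closure, which is open dense.
    A filter is closed upwards, so it meets [D b] as soon as it meets the
    downward closure of [D b].  By distributivity, the intersection [E a] of
    the closures of the [D b] with [b < a] is dense, since an initial segment of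
    a cardinal is smaller than the cardinal.  The sets [E a] decrease with [a];
    a filter that meets unboundedly many of them therefore meets the closure of
    every [D b], at a stage [a] above [b]. *)

Set Implicit Arguments.
Unset Strict Implicit.
Unset Printing Implicit Defensive.

Import Order.TTheory.

Local Open Scope classical_set_scope.
Local Open Scope card_scope.
Local Open Scope order_scope.

Section DownClosure.
Variables (d : Order.disp_t) (P : tPOrderType d).
Implicit Types D g : set P.

Definition down_closure D : set P := [set p | exists2 q, D q & p <= q].

Lemma forcing_open_down_closure D : forcing_open (down_closure D).
Proof. by move=> p q [r Dr le_pr] le_qp; exists r => //; exact: le_trans le_pr. Qed.

Lemma forcing_dense_down_closure D :
  forcing_dense D -> forcing_dense (down_closure D).
Proof. by move=> dD p; have [q Dq le_qp] := dD p; exists q => //; exists q. Qed.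

Lemma forcing_filter_meets_down_closure g D :
  forcing_filter g -> g `&` down_closure D !=set0 -> g `&` D !=set0.
Proof.
by move=> [_ gup _] [p [gp [q Dq le_pq]]]; exists q; split => //; exact: gup le_pq.
Qed.

End DownClosure.

Lemma card_lt_image (T V U : Type) (f : T -> U) (A : set T) (B : set V) :
  card_lt A B -> card_lt (f @` A) B.
Proof.
move=> [leAB nleBA]; split; first exact: card_le_trans (card_image_le f A) leAB.
by move=> leBf; apply: nleBA; exact: card_le_trans leBf (card_image_le f A).
Qed.

(** The segment is strict because these are the sets that the definition of a
    cardinal makes small; the family of the [U b] with [b < a], as an image of
    such a segment, is then small enough for distributivity. *)
Lemma forcing_dense_initial_bigcap (dK dP : Order.disp_t) (K : orderType dK)
    (P : tPOrderType dP) (U : K -> set P) (a : K) :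
    is_cardinal K -> lt_distributive P K ->
    (forall b, forcing_open (U b)) -> (forall b, forcing_dense (U b)) ->
  forcing_dense (\bigcap_(b in [set b | b < a]) U b).
Proof.
move=> [_ smallK] distrP oU dU; rewrite -[X in forcing_dense X](bigcap_image _ _ id).
by apply: distrP => [|_ [b _ <-]]; [exact/card_lt_image/smallK | split].
Qed.

Theorem proposition1p7 (dK dP : Order.disp_t) (K : orderType dK)
    (P : tPOrderType dP) :
  is_uncountable_cardinal K ->
  lt_distributive P K ->
  ub_FA P K ->
  FA P K.
Proof.
move=> [cardK _] distrP ubP D dD.
pose U b := down_closure (D b).
have dE a : forcing_dense (\bigcap_(b in [set b | b < a]) U b).
  apply: forcing_dense_initial_bigcap => // b.
    exact: forcing_open_down_closure.
  exact: forcing_dense_down_closure.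
have [g fg unb] := ubP _ dE.
exists g => // b; apply: forcing_filter_meets_down_closure => //.
apply: contra_notP unb => nUb; exists b => a [p [gp Ep]].
by rewrite leNgt; apply/negP => lt_ba; apply: nUb; exists p; split => //; exact: Ep.
Qed.
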